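(* Let $n$ be a nonnegative integer and let $a,c$ be complex numbers such that no lower parameter of the series below is a nonpositive integer and all denominators below are nonzero. Then $$\frac{(c-a)_n}{(c)_n}={}_5F_4\left[\begin{matrix}-\frac n2,\ \frac{1-n}{2},\ c-a,\ a,\ 1-a\\ \frac c2,\ \frac{c+1}{2},\ \frac12,\ c-a+n\end{matrix};-\frac14\right]-\frac{na(c-a+1)}{c(c-a+n)}\;{}_6F_5\left[\begin{matrix}\frac{1-n}{2},\ \frac{2-n}{2},\ 1+\frac{1+c-a}{3},\ c-a,\ 1+a,\ 1-a\\ \frac{c+1}{2},\ \frac{c+2}{2},\ \frac32,\ \frac{1+c-a}{3},\ c+1-a+n\end{matrix};-\frac14\right].$$
   Context: $(x)_0=1$ and $(x)_n=x(x+1)\cdots(x+n-1)$ for $n\ge1$. The generalized hypergeometric series is ${}_pF_q\left[\begin{matrix}a_1,\dots,a_p\\ b_1,\dots,b_q\end{matrix};z\right]=\sum_{k\ge0}\frac{(a_1)_k\cdots(a_p)_k}{(b_1)_k\cdots(b_q)_k}\frac{z^k}{k!}$, with lower parameters $b_j\in\mathbb{C}\setminus\mathbb{Z}_{\le0}$. The series involved terminate; a term whose coefficient vanishes because of the factor $n$ (when $n=0$) is read as $0$. *)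

(* Defs.v *)
From HB Require Import structures.
From mathcomp Require Import all_boot all_order all_algebra.
From mathcomp Require Import all_classical all_reals all_analysis.

Set Implicit Arguments.
Unset Strict Implicit.
Unset Printing Implicit Defensive.

Import Order.TTheory GRing.Theory Num.Theory.
Import numFieldNormedType.Exports.

Local Open Scope ring_scope.
Local Open Scope classical_set_scope.

Definition poch (F : pzRingType) (x : F) (k : nat) : F :=
  \prod_(0 <= i < k) (x + i%:R).

Definition hyp_term (F : fieldType) (upper lower : seq F) (z : F) (k : nat) : F :=
  (\prod_(a <- upper) poch a k) / (\prod_(b <- lower) poch b k)
  * (z ^+ k / (k`!)%:R).

(* pFq with p = size upper and q = size lower, as an infinite series in the norm
   topology of F; for F = R[i] with R : realType this is the usual complex series.
   The limit operator is total: if the series diverges, its value is an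
   unspecified element of F, so that 0 * pFq = 0 in every case. *)
Definition hyp (F : numFieldType) (upper lower : seq F) (z : F) : F :=
  limn (series (hyp_term upper lower z)).

Definition nonpos_integer (F : pzRingType) (x : F) : Prop :=
  exists m : nat, x = - m%:R.

(* Main.v *)
Require Import Defs.
From mathcomp Require Import all_boot all_order all_algebra.
From mathcomp Require Import all_classical all_reals all_analysis.
From mathcomp Require Import complex.
From mathcomp Require Import ring.

Import GRing.Theory Num.Theory.
Import numFieldNormedType.Exports.
Local Open Scope ring_scope.
Local Open Scope complex_scope.

(** Write [b = c - a] and multiply the identity by [(c)_n]. The two series then
    become finite sums, and the claim reads
    [sum_k (E_k - O_k) = (b)_n], where

    - [E_k = C(n,2k) (b)_k / (b+n)_k * (a-k)_{2k} (a+b+2k)_{n-2k}],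
    - [O_k = C(n,2k+1) (b+1+3k) (b)_k / (b+n)_{k+1}
             * (a-k)_{2k+1} (a+b+2k+1)_{n-2k-1}].

    The right-hand side does not involve [a]. For fixed [b] and [n] the left-hand
    side is a polynomial in [a], since [a] occurs in no denominator, and it is
    invariant under [a -> a + 1]: its difference in [a] is a telescoping sum
    in [k], with the explicit Wilf-Zeilberger mate
    [G_k = - 2k C(n,2k) (b)_k / (b+n)_k * (a-k+1)_{2k-1} (a+b+2k)_{n-2k}]
    ([even_diff], [odd_diff], [sum_shift]). A polynomial of period 1 over a field
    of characteristic zero is constant ([periodic_poly]), so [a] may be set to [0],
    where only [E_0 = (b)_n] survives ([even_sub_odd_sum]).

    Working with a polynomial in [a], rather than by recursion on [n], keeps the
    denominators [(b+n)_k] fixed; for smaller [n] they could vanish.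

    What remains is bookkeeping: the duplication formula [poch_dup] turns the pairs
    of parameters differing by 1/2 into Pochhammer symbols of length [2k], which
    identifies the terms of the first series, and those of the second multiplied by
    its coefficient, with [E_k / (c)_n] and [O_k / (c)_n] ([hyp_term_even],
    [hyp_term_odd]). The limits are finite sums because the series terminate
    ([hyp_terminating]), except possibly the second one for [n = 0], where its
    coefficient vanishes. *)

(** * Pochhammer symbols *)

Lemma poch0 (A : pzRingType) (x : A) : poch x 0 = 1.
Proof. by rewrite /poch big_geq. Qed.

Lemma pochSr (A : pzRingType) (x : A) k : poch x k.+1 = poch x k * (x + k%:R).
Proof. by rewrite /poch big_nat_recr. Qed.

Lemma poch_add (A : pzRingType) (x : A) m k :
  poch x (m + k) = poch x m * poch (x + m%:R) k.
Proof.
elim: k => [|k IH]; first by rewrite addn0 poch0 mulr1.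
by rewrite addnS !pochSr IH natrD mulrA addrA.
Qed.

Lemma pochS (A : pzRingType) (x : A) k : poch x k.+1 = x * poch (x + 1) k.
Proof. by rewrite -add1n poch_add pochSr poch0 mul1r addr0. Qed.

Arguments poch0 {A}.
Arguments pochS {A}.
Arguments pochSr {A}.
Arguments poch_add {A}.

Lemma poch_neq0 (F : numFieldType) (x : F) k :
  ~ nonpos_integer x -> poch x k != 0.
Proof.
move=> xN; elim: k => [|k IH]; first by rewrite poch0 oner_neq0.
rewrite pochSr mulf_neq0 //; apply/eqP => xk0; apply: xN.
by exists k; apply/eqP; rewrite -addr_eq0 xk0.
Qed.

(** Even and odd factors of [(x)_{2k}] are twice those of [(x/2)_k] and
    [((x+1)/2)_k]. *)
Lemma poch_dup (F : numFieldType) (x : F) k :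
  poch (x / 2) k * poch ((x + 1) / 2) k = poch x (2 * k) / 4 ^+ k.
Proof.
elim: k => [|k IH]; first by rewrite muln0 !poch0 expr0 divr1 mulr1.
rewrite mulnS addnC addn2 !pochSr exprS.
have -> : poch (x / 2) k * (x / 2 + k%:R)
          * (poch ((x + 1) / 2) k * ((x + 1) / 2 + k%:R))
        = poch (x / 2) k * poch ((x + 1) / 2) k
          * ((x / 2 + k%:R) * ((x + 1) / 2 + k%:R)) by ring.
rewrite IH -[(2 * k).+1]addn1 natrD natrM.
by field; rewrite expf_neq0 // pnatr_eq0.
Qed.

Lemma poch1 (A : pzRingType) k : poch (1 : A) k = k`!%:R.
Proof.
elim: k => [|k IH]; first by rewrite poch0.
by rewrite pochSr IH factS mulnC natrM -[k.+1]add1n natrD.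
Qed.

(** This is where binomial coefficients come from, and why the series terminate:
    the right-hand side vanishes as soon as [n < m]. *)
Lemma poch_oppn (A : comPzRingType) n m :
  poch (- n%:R : A) m = (-1) ^+ m * (m`! * 'C(n, m))%:R.
Proof.
elim: m => [|m IH]; first by rewrite poch0 bin0 expr0 mulr1.
have [le_mn|lt_nm] := leqP m n; last first.
  by rewrite pochSr IH !bin_small ?muln0 ?mulr0 ?mul0r // ltnW.
rewrite pochSr IH factS [(m.+1 * _)%N]mulnC -mulnA mul_bin_left !natrM.
by rewrite natrB // exprS; ring.
Qed.

(** Reversing the factors of [(1 - x)_k] makes them descend from [x - 1], so that
    they extend the run [x, x + 1, ...] to the left; the sign is the one of the
    argument [-1/4]. *)
Lemma poch_reflect (A : comPzRingType) (x : A) k :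
  (-1) ^+ k * (poch x k * poch (1 - x) k) = poch (x - k%:R) (2 * k).
Proof.
rewrite mul2n -addnn poch_add subrK mulrCA mulrC; congr (_ * _).
elim: k => [|k IH]; first by rewrite !poch0 mulr1.
rewrite pochSr exprS pochS.
have -> : x - k.+1%:R + 1 = x - k%:R by rewrite -addn1 natrD; ring.
by rewrite -IH -addn1 natrD; ring.
Qed.

(** The discrete Leibniz rule for the difference operator [x -> x + 1] acting on
    both factors at once; the truncated predecessors are harmless because of the
    factors [p] and [m] in front of them. *)
Lemma poch_leibniz (A : comPzRingType) (x y : A) p m :
  poch (x + 1) p * poch (y + 1) m - poch x p * poch y m
  = p%:R * (poch (x + 1) p.-1 * poch y m)
    + m%:R * (poch (x + 1) p * poch (y + 1) m.-1).
Proof.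
case: p => [|p]; case: m => [|m]; rewrite /= ?poch0.
- ring.
- rewrite (pochSr (y + 1)) (pochS y) -natr1; ring.
- rewrite (pochSr (x + 1)) (pochS x) -natr1; ring.
- rewrite (pochSr (x + 1)) (pochS x) (pochSr (y + 1)) (pochS y) -!natr1; ring.
Qed.

(** * Periodic polynomials *)

(** [p - p(0)] vanishes at every natural number, hence has too many roots. *)
Lemma periodic_poly (F : numFieldType) (p : {poly F}) :
  (forall x, p.[x + 1] = p.[x]) -> forall x, p.[x] = p.[0].
Proof.
move=> per x.
have perN (i : nat) : p.[i%:R] = p.[0].
  by elim: i => // i IH; rewrite -addn1 natrD per.
suff /eqP : p - p.[0]%:P == 0.
  by move/(congr1 (horner^~ x)); rewrite !hornerE => /subr0_eq.
apply: contraT => nz.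
pose rs := [seq i%:R : F | i <- iota 0 (size (p - p.[0]%:P))].
have /max_poly_roots := nz; move=> /(_ rs).
rewrite size_map size_iota ltnn; apply.
  by apply/allP => _ /mapP[i _ ->]; rewrite rootE !hornerE perN subrr.
rewrite map_inj_uniq ?iota_uniq // => i j /eqP.
by rewrite eqr_nat => /eqP.
Qed.

(** * The telescoping identity *)

Section Telescoping.
Variables (F : numFieldType) (n : nat) (b : F).

Definition ratio (k : nat) : F := poch b k / poch (b + n%:R) k.

Definition even_term (a : F) (k : nat) : F :=
  'C(n, 2 * k)%:R * ratio k
  * (poch (a - k%:R) (2 * k) * poch (a + b + (2 * k)%:R) (n - 2 * k)).

Definition odd_term (a : F) (k : nat) : F :=
  'C(n, (2 * k).+1)%:R * (b + 1 + (3 * k)%:R) * (ratio k / (b + n%:R + k%:R))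
  * (poch (a - k%:R) (2 * k).+1
     * poch (a + b + (2 * k).+1%:R) (n - (2 * k).+1)).

(** The Wilf-Zeilberger mate of [even_term - odd_term] with respect to the
    shift of [a]. At [k = 0] it vanishes thanks to the factor [2k], so the
    truncated predecessor does no harm. *)
Definition wz_mate (a : F) (k : nat) : F :=
  - ((2 * k)%:R * 'C(n, 2 * k)%:R * ratio k
     * (poch (a - k%:R + 1) (2 * k).-1 * poch (a + b + (2 * k)%:R) (n - 2 * k))).

(** An intermediate value between [wz_mate a k] and [wz_mate a k.+1]: the
    difference of [even_term] leads from the first to it, that of [odd_term] from
    it to the second, so that each needs only its own Leibniz rule. *)
Definition wz_half (a : F) (k : nat) : F :=
  (2 * k).+1%:R * 'C(n, (2 * k).+1)%:R * ratio k
  * (poch (a - k%:R + 1) (2 * k)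
     * poch (a + b + (2 * k).+1%:R) (n - (2 * k).+1)).

(** The first half of the Leibniz rule is cancelled by [wz_mate a k]; the second
    half is [wz_half a k] because of [(m+1) C(n,m+1) = (n-m) C(n,m)]. *)
Lemma even_diff a k :
  even_term (a + 1) k - even_term a k + wz_mate a k = wz_half a k.
Proof.
rewrite /even_term /wz_mate /wz_half subnS.
have -> : a + 1 - k%:R = a - k%:R + 1 by ring.
have -> : a + 1 + b + (2 * k)%:R = a + b + (2 * k)%:R + 1 by ring.
have -> : a + b + (2 * k).+1%:R = a + b + (2 * k)%:R + 1.
  by rewrite -addn1 natrD addrA.
rewrite -mulrBr poch_leibniz.
have -> : (2 * k).+1%:R * 'C(n, (2 * k).+1)%:R
        = (n - 2 * k)%:R * 'C(n, 2 * k)%:R :> F.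
  by rewrite -!natrM mul_bin_left.
ring.
Qed.

Hypothesis b_shift_neq0 : forall k, b + n%:R + k%:R != 0.

(** The factor [b + 1 + 3k] of [odd_term] is the one for which this holds: after
    the common factors are removed, what is left is
    [(b+1+3k)(a+k+1) - (b+k)(a-k) = (2k+1)(a+b+2k+1)]. *)
Lemma odd_diff a k :
  wz_half a k - (odd_term (a + 1) k - odd_term a k) = wz_mate a k.+1.
Proof.
have D0 := b_shift_neq0 k.
have E2 : (2 * k.+1 = (2 * k).+2)%N by rewrite mulnS.
rewrite /odd_term /wz_mate /wz_half E2.
have -> : ratio k.+1 = ratio k * (b + k%:R) / (b + n%:R + k%:R).
  by rewrite /ratio !pochSr invfM; ring.
have -> : (2 * k).+2%:R * 'C(n, (2 * k).+2)%:R
        = (n - (2 * k).+1)%:R * 'C(n, (2 * k).+1)%:R :> F.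
  by rewrite -!natrM mul_bin_left.
have -> : a + 1 - k%:R = a - k%:R + 1 by ring.
have -> : a + 1 + b + (2 * k).+1%:R = a + b + (2 * k).+1%:R + 1 by ring.
have -> : a + b + (2 * k).+2%:R = a + b + (2 * k).+1%:R + 1.
  by rewrite -[(2 * k).+2]addn1 natrD addrA.
have -> : a - k.+1%:R + 1 = a - k%:R by rewrite -addn1 natrD; ring.
rewrite -mulrBr poch_leibniz /= (subnS n (2 * k).+1).
have [lt_nk|le_kn] := ltnP n (2 * k).+1.
  by rewrite bin_small // !(mul0r, mulr0) subrr oppr0.
have En : n%:R = (2 * k).+1%:R + (n - (2 * k).+1)%:R :> F.
  by rewrite -natrD subnKC.
move: D0; rewrite {}En.
move: (ratio k) ('C(_, _)%:R) (n - _)%N => w C m.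
rewrite (pochS (a - _)) (pochSr (a - _ + 1)).
have -> : (2 * k).+1%:R = 2 * k%:R + 1 :> F by rewrite -natr1 natrM.
rewrite !natrM; move: (poch (a - k%:R + 1) (2 * k)) (k%:R : F) => P K.
(* For m = 0, that is n = 2k+1, the mate is 0 and b+1+3k = b+n+k. *)
case: m => [|m]; last rewrite (pochS (a + b + _)) -[m.+1%:R]natr1 /=.
  rewrite /= !poch0 => D0; field.
  by move: D0; rewrite addr0.
move: (poch (a + b + (2 * K + 1) + 1) m) (m%:R : F) => Q M D0.
by field.
Qed.

(** The sum of the differences telescopes between [G_0 = 0], because of the factor
    [2k], and [G_{n+1} = 0], because of [C(n,2n+2)]. *)
Lemma sum_shift a :
  \sum_(k < n.+1) (even_term (a + 1) k - odd_term (a + 1) k)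
  = \sum_(k < n.+1) (even_term a k - odd_term a k).
Proof.
apply/eqP; rewrite -subr_eq0 -sumrB.
rewrite (eq_bigr (fun k : 'I_n.+1 => wz_mate a k.+1 - wz_mate a k)); last first.
  by move=> k _; rewrite -odd_diff -even_diff; ring.
rewrite -(big_mkord xpredT (fun k => wz_mate a k.+1 - wz_mate a k)).
rewrite telescope_sumr //.
rewrite /wz_mate muln0 bin_small ?(ltnW (ltn_Pmull _ _)) //.
by rewrite !(mul0r, mulr0) subrr.
Qed.

Lemma horner_poch (p : {poly F}) k x : (poch p k).[x] = poch p.[x] k.
Proof.
by rewrite horner_prod; apply: eq_bigr => i _; rewrite -polyC_natr !hornerE.
Qed.

Lemma even_sub_odd_sum a :
  \sum_(k < n.+1) (even_term a k - odd_term a k) = poch b n.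
Proof.
pose p : {poly F} := \sum_(k < n.+1)
  (('C(n, 2 * k)%:R * ratio k)%:P
   * (poch ('X - k%:R%:P) (2 * k)
      * poch ('X + b%:P + (2 * k)%:R%:P) (n - 2 * k))
   - ('C(n, (2 * k).+1)%:R * (b + 1 + (3 * k)%:R)
      * (ratio k / (b + n%:R + k%:R)))%:P
     * (poch ('X - k%:R%:P) (2 * k).+1
        * poch ('X + b%:P + (2 * k).+1%:R%:P) (n - (2 * k).+1))).
have pE x : p.[x] = \sum_(k < n.+1) (even_term x k - odd_term x k).
  rewrite horner_sum; apply: eq_bigr => k _.
  by rewrite !(hornerD, hornerN, hornerM, hornerC, horner_poch, hornerX).
rewrite -pE periodic_poly => [|x]; last by rewrite !pE sum_shift.
(* At a = 0 the symbols (-k)_{2k} and (-k)_{2k+1} contain the factor 0 for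
   k > 0, and (0)_1 = 0 removes the odd term at k = 0. *)
rewrite pE big_ord_recl big1 => [|k _].
  rewrite /even_term /odd_term /ratio muln0 !poch0 bin0 pochSr subrr !add0r.
  by rewrite !(mul0r, mulr0, mul1r, mulr1, invr1, subr0, addr0) subn0.
have lt_k2 : (k.+1 < 2 * k.+1)%N by exact: ltn_Pmull.
have poch_oppn0 j : (k.+1 < j)%N -> poch (0 - k.+1%:R) j = 0 :> F.
  by move=> lt_kj; rewrite sub0r poch_oppn bin_small // muln0 mulr0.
rewrite /even_term /odd_term lift0 !poch_oppn0 //; last exact: ltnW.
by rewrite !(mul0r, mulr0) subrr.
Qed.

End Telescoping.
Arguments ratio {F}.
Arguments even_term {F}.
Arguments odd_term {F}.

(** * Terms of the hypergeometric series *)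

Lemma hyp_terminating (F : numFieldType) (upper lower : seq F) (z : F) N :
  (forall k, (N <= k)%N -> hyp_term upper lower z k = 0) ->
  hyp upper lower z = \sum_(k < N) hyp_term upper lower z k.
Proof.
move=> h0; rewrite /hyp; apply: (@cvg_lim F); first exact: norm_hausdorff.
apply: cvg_near_cst; exists N => // m /= le_Nm.
rewrite /series /= (@big_cat_nat _ _ _ N) //= [X in _ + X]big_nat_cond.
rewrite [X in _ + X]big1 ?addr0 ?big_mkord //.
by move=> i /andP[/andP[leNi _] _]; exact: h0.
Qed.

Section Terms.
Variables (F : numFieldType) (n : nat) (a c : F).
Hypothesis poch_c_neq0 : forall j, poch c j != 0.
Hypothesis poch_can_neq0 : forall j, poch (c - a + n%:R) j != 0.

Lemma pow4_neq0 k : 4 ^+ k != 0 :> F.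
Proof. by rewrite expf_neq0 // pnatr_eq0. Qed.

Lemma fact_neq0 k : k`!%:R != 0 :> F.
Proof. by rewrite pnatr_eq0 -lt0n fact_gt0. Qed.

Lemma poch_half_fact k :
  poch (1 / 2) k * k`!%:R = (2 * k)`!%:R / 4 ^+ k :> F.
Proof.
rewrite -poch1 -poch1 -poch_dup; congr (_ * poch _ _).
by field.
Qed.

Lemma poch_three_halves_fact k :
  poch (3 / 2) k * k`!%:R = (2 * k).+1`!%:R / 4 ^+ k :> F.
Proof.
rewrite -poch1 -[(2 * k).+1`!%:R]poch1 pochS mul1r -poch_dup mulrC.
by congr (poch _ _ * poch _ _); field.
Qed.

Lemma poch_oppn_dup k :
  poch (- (n%:R / 2)) k * poch ((1 - n%:R) / 2) k
  = (2 * k)`!%:R * 'C(n, 2 * k)%:R / 4 ^+ k :> F.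
Proof.
rewrite -mulNr [1 - _]addrC poch_dup poch_oppn exprM sqrrN expr1n expr1n mul1r.
by rewrite natrM.
Qed.

Lemma hyp_term_even k :
  hyp_term [:: - (n%:R / 2); (1 - n%:R) / 2; c - a; a; 1 - a]
           [:: c / 2; (c + 1) / 2; 1 / 2; c - a + n%:R] (- (1 / 4)) k
  = even_term n (c - a) a k / poch c n.
Proof.
rewrite /hyp_term !big_cons !big_nil /even_term /ratio.
have [lt_nk|le_kn] := ltnP n (2 * k).
  rewrite bin_small // !mul0r [poch _ k * (poch _ k * _)]mulrA.
  by rewrite poch_oppn_dup bin_small // mulr0 !mul0r.
have -> : a + (c - a) + (2 * k)%:R = c + (2 * k)%:R by ring.
have cs := poch_add c (2 * k) (n - 2 * k); rewrite subnKC // in cs.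
have := poch_c_neq0 n; rewrite cs mulf_eq0 negb_or => /andP[nz1 nz2].
have nz3 := poch_can_neq0 k.
rewrite -poch_reflect.
have -> : (- (1 / 4)) ^+ k = (-1) ^+ k / 4 ^+ k :> F.
  by rewrite mul1r -[- 4^-1]mulN1r exprMn exprVn.
transitivity ((poch (- (n%:R / 2)) k * poch ((1 - n%:R) / 2) k)
  * (poch (c - a) k * poch a k * poch (1 - a) k * (-1) ^+ k / 4 ^+ k)
  / ((poch (c / 2) k * poch ((c + 1) / 2) k) * (poch (1 / 2) k * k`!%:R)
     * poch (c - a + n%:R) k)).
  by rewrite !invfM invr1; ring.
rewrite poch_oppn_dup poch_half_fact poch_dup.
move: (pow4_neq0 k) (fact_neq0 (2 * k)).
move: (4 ^+ k) ((-1) ^+ k) (poch (1 - a) k) nz1 nz2 nz3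
  => p4 s q nz1 nz2 nz3 n4 nf.
by field; rewrite n4 nf nz1 nz2 nz3.
Qed.

Hypothesis poch_third_neq0 : forall j, poch ((1 + c - a) / 3) j != 0.

(** The prefactor [n] supplies the missing first factor of [(-n)_{2k+1}]. *)
Lemma poch_oppn_dup_succ k :
  n%:R * (poch ((1 - n%:R) / 2) k * poch ((2 - n%:R) / 2) k)
  = (2 * k).+1`!%:R * 'C(n, (2 * k).+1)%:R / 4 ^+ k :> F.
Proof.
have -> : (2 - n%:R) / 2 = (1 - n%:R + 1) / 2 :> F by field.
rewrite poch_dup mulrA; congr (_ / _).
have := poch_oppn F n (2 * k).+1.
rewrite pochS exprS exprM sqrrN !expr1n natrM [- _ + 1]addrC => e.
by apply: oppr_inj; rewrite -mulNr e; ring.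
Qed.

(** Each factor of the coefficient completes a symbol of the series: [n], [a], [c]
    and [c - a + n] prepend a first factor, while [c - a + 1 = 3s] with
    [s = (1 + c - a) / 3] clears the denominator of
    [(1 + s)_k / (s)_k = (s + k) / s], leaving [c - a + 1 + 3k]. *)
Lemma hyp_term_odd k :
  n%:R * a * (c - a + 1) / (c * (c - a + n%:R))
  * hyp_term [:: (1 - n%:R) / 2; (2 - n%:R) / 2; 1 + (1 + c - a) / 3;
                 c - a; 1 + a; 1 - a]
             [:: (c + 1) / 2; (c + 2) / 2; 3 / 2; (1 + c - a) / 3;
                 c + 1 - a + n%:R] (- (1 / 4)) k
  = odd_term n (c - a) a k / poch c n.
Proof.
rewrite /hyp_term !big_cons !big_nil /odd_term /ratio.
have -> : (- (1 / 4)) ^+ k = (-1) ^+ k / 4 ^+ k :> F.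
  by rewrite mul1r -[- 4^-1]mulN1r exprMn exprVn.
set s := (1 + c - a) / 3.
have Es : c - a + 1 = 3 * s by rewrite /s; field.
have nz_s : s != 0 by have := poch_third_neq0 1; rewrite pochS poch0 mulr1.
have nz_sk := poch_third_neq0 k; rewrite -/s in nz_sk.
have Esk : poch (1 + s) k = poch s k * (s + k%:R) / s.
  by rewrite -pochSr pochS [1 + s]addrC mulrAC divff ?mul1r.
have Ec : c * (poch ((c + 1) / 2) k * poch ((c + 2) / 2) k)
        = poch c (2 * k).+1 / 4 ^+ k.
  have -> : (c + 2) / 2 = (c + 1 + 1) / 2 by field.
  by rewrite poch_dup pochS mulrA.
have Eb : (c - a + n%:R) * poch (c + 1 - a + n%:R) k
        = poch (c - a + n%:R) k * (c - a + n%:R + k%:R).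
  by rewrite -pochSr pochS; congr (_ * poch _ _); ring.
have Ea : a * poch (1 + a) k * poch (1 - a) k * (-1) ^+ k
        = poch (a - k%:R) (2 * k).+1.
  rewrite [1 + a]addrC -pochS !pochSr -poch_reflect natrM; ring.
have nz_b : poch (c - a + n%:R) k * (c - a + n%:R + k%:R) != 0.
  by rewrite -pochSr.
transitivity ((n%:R * (poch ((1 - n%:R) / 2) k * poch ((2 - n%:R) / 2) k))
  * (a * poch (1 + a) k * poch (1 - a) k * (-1) ^+ k)
  * (3 * s * (poch s k * (s + k%:R) / s) * poch (c - a) k / 4 ^+ k)
  / ((c * (poch ((c + 1) / 2) k * poch ((c + 2) / 2) k))
     * (poch (3 / 2) k * k`!%:R) * poch s k
     * ((c - a + n%:R) * poch (c + 1 - a + n%:R) k))).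
  by rewrite Es Esk !invfM invr1; ring.
rewrite poch_oppn_dup_succ Ea Ec Eb poch_three_halves_fact.
have -> : c - a + 1 + (3 * k)%:R = 3 * (s + k%:R) by rewrite Es natrM mulrDr.
have [lt_nk|le_kn] := ltnP n (2 * k).+1.
  by rewrite bin_small // !(mulr0, mul0r).
have -> : a + (c - a) + (2 * k).+1%:R = c + (2 * k).+1%:R by ring.
have cs := poch_add c (2 * k).+1 (n - (2 * k).+1); rewrite subnKC // in cs.
have := poch_c_neq0 n; rewrite cs mulf_eq0 negb_or => /andP[nz1 nz2].
move: nz_b; rewrite mulf_eq0 negb_or => /andP[nz3 nz4].
move: (pow4_neq0 k) (fact_neq0 (2 * k).+1).
move: (4 ^+ k) (c + (2 * k).+1%:R) nz2 => p4 y nz2 n4 nf.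
by field; rewrite n4 nf nz1 nz2 nz3 nz4 nz_s nz_sk.
Qed.

End Terms.

(** * The theorem *)

Theorem theorem3p3 (R : realType) (n : nat) (a c : R[i])
  (hlower1 : forall b : R[i],
     b \in [:: c / 2; (c + 1) / 2; 1 / 2; c - a + n%:R] ->
     ~ nonpos_integer b)
  (hlower2 : forall b : R[i],
     b \in [:: (c + 1) / 2; (c + 2) / 2; 3 / 2; (1 + c - a) / 3;
               c + 1 - a + n%:R] ->
     ~ nonpos_integer b)
  (hden1 : poch c n != 0)
  (hden2 : c * (c - a + n%:R) != 0) :
  poch (c - a) n / poch c n =
    hyp [:: - (n%:R / 2); (1 - n%:R) / 2; c - a; a; 1 - a]
        [:: c / 2; (c + 1) / 2; 1 / 2; c - a + n%:R]
        (- (1 / 4))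
    - n%:R * a * (c - a + 1) / (c * (c - a + n%:R))
      * hyp [:: (1 - n%:R) / 2; (2 - n%:R) / 2; 1 + (1 + c - a) / 3;
                c - a; 1 + a; 1 - a]
            [:: (c + 1) / 2; (c + 2) / 2; 3 / 2; (1 + c - a) / 3;
                c + 1 - a + n%:R]
            (- (1 / 4)).
Proof.
have poch_can_neq0 j : poch (c - a + n%:R) j != 0.
  by apply/poch_neq0/hlower1; rewrite !inE eqxx !orbT.
have poch_third_neq0 j : poch ((1 + c - a) / 3) j != 0.
  by apply/poch_neq0/hlower2; rewrite !inE eqxx !orbT.
have poch_c_neq0 j : poch c j != 0.
  have : poch c (2 * j) != 0.
    have nz : poch (c / 2) j * poch ((c + 1) / 2) j != 0.
      by rewrite mulf_neq0 //; apply/poch_neq0/hlower1; rewrite !inE eqxx ?orbT.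
    by apply: contraNneq nz => c0; rewrite poch_dup c0 mul0r.
  by rewrite mul2n -addnn poch_add mulf_eq0 negb_or => /andP[].
have lt_2k k : (n < k)%N -> (n < 2 * k)%N.
  by move=> lt_nk; rewrite (leq_trans lt_nk) // leq_pmull.
rewrite (@hyp_terminating _ _ _ _ n.+1) => [|k lt_nk]; last first.
  by rewrite hyp_term_even // /even_term bin_small ?lt_2k // !mul0r.
under eq_bigr do rewrite hyp_term_even //.
have -> : n%:R * a * (c - a + 1) / (c * (c - a + n%:R))
      * hyp [:: (1 - n%:R) / 2; (2 - n%:R) / 2; 1 + (1 + c - a) / 3;
                c - a; 1 + a; 1 - a]
            [:: (c + 1) / 2; (c + 2) / 2; 3 / 2; (1 + c - a) / 3;
                c + 1 - a + n%:R]
            (- (1 / 4))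
  = \sum_(k < n.+1) odd_term n (c - a) a k / poch c n.
  have [n0|n_gt0] := posnP n.
    rewrite n0 !mul0r big1 // => k _.
    by rewrite /odd_term bin_small // !mul0r.
  rewrite (@hyp_terminating _ _ _ _ n.+1) => [|k lt_nk].
    by rewrite mulr_sumr; under eq_bigr do rewrite hyp_term_odd //.
  have := poch_oppn_dup_succ R[i] n k.
  rewrite bin_small ?ltnS ?(ltnW (lt_2k _ _)) // mulr0 mul0r => /eqP.
  rewrite mulf_eq0 pnatr_eq0 eqn0Ngt n_gt0 => /eqP z0.
  by rewrite /hyp_term !big_cons mulrA z0 !mul0r.
rewrite -sumrB.
under eq_bigr do rewrite -mulrBl.
rewrite -mulr_suml even_sub_odd_sum // => k.
by have := poch_can_neq0 k.+1; rewrite pochSr mulf_eq0 negb_or => /andP[].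
Qed.
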